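(* For all integers $r\ge 1$ and $t\ge 2$ we have $$\mathcal{J}(r,t)\subseteq \mathcal{F}\bigl(t,\,rt,\,(rt^2)^{r^3t^6}\bigr).$$
   Context: A $k$-graph ($k$-uniform hypergraph) is a pair $H=(V,E)$ where $E$ is a set of $k$-element subsets of the finite vertex set $V$; $H$ is identified with its edge set, so $|H|$ is its number of edges. For $U\subseteq V$, $H[U]$ denotes the set of edges of $H$ contained in $U$. The class $\mathcal{J}(r,t)$: for integers $r\ge1$, $t\ge2$ let $I=\{s\ge 0 : t\mid s \text{ or } s\ge rt(t-1)\}$. $\mathcal{J}(r,t)$ consists of all $rt^2$-graphs $H$ with $|e\cap f|\in I$ for all edges $e,f$ of $H$. Stars: for $k\ge s\ge0$, an $s$-star is a $k$-graph $(V,E)$ together with a distinguished set $S\subseteq V$, $|S|=s$, such that $S\subseteq e$ for all $e\in E$. $S$ is the centre of the star and $\bigcup_{h\in E}(h\setminus S)$ is its body. A collection of stars is semi-disjoint if their centres are distinct and their bodies are mutually disjoint. Inseparable sets: $W\subseteq V$ is inseparable in $H=(V,E)$ if $W\cap h\in\{\emptyset,W\}$ for all $h\in E$. The class $\mathcal{F}(t,\ell,a)$: for positive integers $t,\ell,a$, an $\ell t$-graph $H=(V,E)$ with $n=|V|$ belongs to $\mathcal{F}(t,\ell,a)$ if there exist partitions (parts may be empty) $V=V_T\cup V_S\cup V_R$ and $H=H_T\cup H_S\cup H_R$ (of the edge set) such that (i) $V_T$ is a union of inseparable $t$-subsets of $V$, and $H_T=H[V_T]$; (ii) $H_S=\{h\in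 H: |h\cap V_S|=\ell\}$ consists of semi-disjoint $(\ell(t-1))$-stars with their centres in $V_T\cup V_R$ and their bodies in $V_S$; (iii) any edge of $H$ that intersects the body of a star $S^*\subseteq H_S$ (one of these stars) contains the centre of $S^*$; (iv) $|H_R|\le |V_T|\,|V_S|\,n^{\ell-3}+|V_R|\,a\,n^{\ell-2}$. *)

(* Defs.v *)
From mathcomp Require Import all_boot all_order all_algebra.
Set Implicit Arguments. Unset Strict Implicit. Unset Printing Implicit Defensive.
Import Order.TTheory GRing.Theory Num.Theory.

(* A hypergraph is identified with its edge set; its vertex set is the whole
   finite type V, so isolated vertices are allowed and n = #|V|. *)

Section Hypergraphs.
Variable V : finType.
Implicit Types (H E : {set {set V}}) (S W h e f : {set V}).

Definition kgraph (k : nat) H : Prop := forall e, e \in H -> #|e| = k.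

Definition induced H (U : {set V}) : {set {set V}} := [set h in H | h \subset U].

Definition inseparable H W : Prop :=
  forall h, h \in H -> W :&: h = set0 \/ W :&: h = W.

(* A star is encoded as the pair (edge set, centre). *)
Local Notation star := ({set {set V}} * {set V})%type.
Definition star_edges (X : star) : {set {set V}} := X.1.
Definition centre (X : star) : {set V} := X.2.
Definition body (X : star) : {set V} :=
  \bigcup_(h in star_edges X) (h :\: centre X).

Definition is_star (k s : nat) (X : star) : Prop :=
  [/\ kgraph k (star_edges X), #|centre X| = s
    & forall h, h \in star_edges X -> centre X \subset h].

Definition semi_disjoint (C : {set star}) : Prop :=
  forall X Y : star, X \in C -> Y \in C -> X != Y ->
    centre X != centre Y /\ [disjoint body X & body Y].

End Hypergraphs.

(* Partition of D into three possibly empty parts; the library's [partition]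
   excludes empty blocks. *)
Definition partition3 (T : finType) (D A B C : {set T}) : Prop :=
  [/\ A :|: B :|: C = D, [disjoint A & B], [disjoint A & C]
    & [disjoint B & C]].

Definition allowed (r t s : nat) : bool := (t %| s) || (r * t * (t - 1) <= s).

Definition inJ (r t : nat) (V : finType) (H : {set {set V}}) : Prop :=
  kgraph (r * t ^ 2) H /\
  forall e f, e \in H -> f \in H -> allowed r t #|e :&: f|.

(* The exponents l - 3 and l - 2 may be negative (already for l = 2), hence
   integer powers over the rationals.  For n = 0, where a negative power takes
   the junk value 0, the factors #|VT| and #|VR| vanish anyway. *)
Definition HR_bound (V : finType) (l a : nat) (VT VS VR : {set V})
    (HR : {set {set V}}) : Prop :=
  (#|HR|%:R <= #|VT|%:R * #|VS|%:R * (#|V|%:R : rat) ^ (l%:Z - 3%:Z)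
    + #|VR|%:R * a%:R * (#|V|%:R : rat) ^ (l%:Z - 2%:Z))%R.

Definition inF (t l a : nat) (V : finType) (H : {set {set V}}) : Prop :=
  kgraph (l * t) H /\
  exists (VT VS VR : {set V}) (HT HS HR : {set {set V}}),
    [/\ partition3 [set: V] VT VS VR /\ partition3 H HT HS HR,
        (exists P : {set {set V}},
           (forall W, W \in P -> #|W| = t /\ inseparable H W) /\
           VT = \bigcup_(W in P) W)
        /\ HT = induced H VT,
        HS = [set h in H | #|h :&: VS| == l],
        exists C : {set {set {set V}} * {set V}},
          [/\ HS = \bigcup_(X in C) star_edges X,
              forall X, X \in C -> is_star (l * t) (l * (t - 1)) X,
              semi_disjoint C,
              forall X, X \in C ->
                centre X \subset VT :|: VR /\ body X \subset VS
            & forall X h, X \in C -> h \in H -> h :&: body X != set0 ->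
                centre X \subset h]
      & HR_bound l a VT VS VR HR].

(* Main.v *)
Require Import Defs.
From mathcomp Require Import all_boot all_order all_algebra.
From mathcomp Require Import zify.

Set Implicit Arguments. Unset Strict Implicit. Unset Printing Implicit Defensive.

(** Write l = r t, c = l (t - 1) and k = r t^2 = c + l; two edges meet in a
multiple of t vertices or in at least c vertices.

Call a set S free when, for each edge h, some edge f containing S satisfies
f :&: h \subset S (a weak form of being the kernel of a large sunflower).
Free sets have admissible intersections with each other and with edges. A
non-free S has a blocking edge, which every edge containing S meets outside S.
A subset of an edge h is closed in h when it absorbs the trace on h of the
blocking edge of each of its subsets. Closed sets are stable under
intersection and they are free, so the closed subsets of h form a lattice in
which all sizes are admissible. Moreover, an edge h which is the hull of a set
A can be recovered from A with boundedly many choices, because each step of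
the closure adds a vertex of one of at most 2^k edges ([card_spanned]). Hence,
with a = (2^k k)^k <= k^(k^3), all but at most a n^(l-2) of the edges h through
a given vertex v are robust at v: no set of fewer than l vertices of h that
contains v has hull h. Robustness means that hulls are small ([card_hull]).

V_T is the union of the inseparable t-sets. V_S consists of the tips: the
vertices y outside V_T for which there is a free c-set C not containing y with
C + y free. Then C lies in every edge through y, because the intersections of
such an edge with C and with C + y both have admissible sizes, which differ by
1; C is unique and contains no tip, so
that the edges with l vertices in V_S form semi-disjoint stars. V_R is what
remains.

Let h be an edge that is robust at all its vertices in V_R, is not inside V_T,
and does not contain a tip y together with a vertex of V_T outside the centre
of y. Then h is an edge of a star. If h contains a tip y with centre C, then
each vertex of V_R in h lies in C ([VR_in_tip]), so h minus C consists of
tips. If h contained no tip, it would have a vertex v in V_R. Adding a vertex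
to a proper closed set would then enlarge the hull by at least t
([jump_geq]), and the hull of v would already have 2 t vertices
([card_hull_VR]); so l - 1 vertices would generate l t = k vertices, that is
all of h, against robustness.

So an edge of H_R either is not robust at a vertex of V_R, which happens for at
most a n^(l-2) edges per vertex, or contains a tip y and a vertex x of V_T
outside its centre. In the second case it contains y, its centre and the
inseparable t-set of x, and t >= 2 leaves at most n^(l-3) possibilities for each
pair (x, y). *)

(** * Counting sets *)

Section Counting.
Variable V : finType.
Implicit Types (A B Q h : {set V}).

Lemma bin_leq_exp n m : 'C(n, m) <= n ^ m.
Proof.
apply: leq_trans (_ : n ^_ m <= _).
  by rewrite -bin_ffact leq_pmulr ?fact_gt0.
elim: m n => [|m IH] n; first by rewrite ffactn0.
case: n => [|n]; first by rewrite ffact0n.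
rewrite ffactnS expnS leq_mul2l (leq_trans (IH n)) ?orbT //.
by case: m {IH} => // m; rewrite leq_exp2r.
Qed.

Lemma card_supersets Q m :
  #|[set A : {set V} | Q \subset A & #|A| == m + #|Q|]| <= #|V| ^ m.
Proof.
apply: leq_trans (bin_leq_exp _ _); rewrite -card_draws.
rewrite -(@card_in_imset _ _ (fun A => A :\: Q)).
  apply/subset_leq_card/subsetP=> _ /imsetP[A /[!inE] /andP[QA /eqP cA] ->].
  by rewrite cardsD (setIidPr QA) cA addnK.
move=> A B /[!inE] /andP[QA _] /andP[QB _] eAB.
by rewrite -(setID A Q) -(setID B Q) eAB (setIidPr QA) (setIidPr QB).
Qed.

Lemma card_bigcup (I T : finType) (P : {set I}) (F : I -> {set T}) b :
  (forall i, i \in P -> #|F i| <= b) -> #|\bigcup_(i in P) F i| <= #|P| * b.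
Proof.
move=> Fb; rewrite -sum_nat_const.
apply: (@leq_trans (\sum_(i in P) #|F i|)); last exact: leq_sum.
elim/big_rec2: _ => [|i m A _ IH]; first by rewrite cards0.
by rewrite cardsU (leq_trans (leq_subr _ _)) ?leq_add2l.
Qed.
Lemma extend_subset A h m : A \subset h -> #|A| <= m -> m <= #|h| ->
  exists B, [/\ A \subset B, B \subset h & #|B| = m].
Proof.
move=> Ah Am mh; have [j] : exists j, m = j + #|A|.
  by exists (m - #|A|); rewrite subnK.
elim: j A Ah {Am} => [|j IH] A Ah em; first by exists A; rewrite subxx Ah em.
have [x xh xA] : exists2 x, x \in h & x \notin A.
  by apply/subsetPn/negP=> /subset_leq_card; move: em mh; clear; lia.
have xAh : x |: A \subset h by rewrite subUset sub1set xh.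
have [B [AB Bh cB]] : exists B, [/\ x |: A \subset B, B \subset h & #|B| = m].
  by apply: IH xAh _; rewrite cardsU1 xA em; clear; lia.
by exists B; rewrite (subset_trans _ AB) ?subsetUr.
Qed.

End Counting.

(** * Free sets and closure inside an edge *)

Section Closure.
Variables (V : finType) (H : {set {set V}}).
Implicit Types (A B S W C e f h : {set V}).

Definition free S :=
  [forall h in H, exists f in H, (S \subset f) && (f :&: h \subset S)].

Lemma freeP S h : free S -> h \in H ->
  exists f, [/\ f \in H, S \subset f & f :&: h \subset S].
Proof.
move=> /forallP /(_ h) /implyP fS /fS /existsP[f /and3P[]]; by exists f.
Qed.

(** A fixed edge witnessing that S is not free; empty for free S, so that free
sets impose no closure condition. *)
Definition blocker S : {set V} :=
  if [pick h in H | [forall f in H, (S \subset f) ==> ~~ (f :&: h \subset S)]]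
  is Some h then h else set0.

Lemma blockerP S f : ~~ free S -> f \in H -> S \subset f ->
  ~~ (f :&: blocker S \subset S).
Proof.
move=> nfS fH Sf; rewrite /blocker; case: pickP => [h /andP[_]|].
  by move=> /forallP /(_ f); rewrite fH Sf.
move=> none; case/negP: nfS; apply/forallP=> h; apply/implyP=> hH.
move: (none h); rewrite hH /= => /negbT; rewrite negb_forall => /existsP[g].
rewrite !negb_imply => /and4P[gH Sg gh _]; apply/existsP; exists g.
by rewrite gH Sg.
Qed.

Lemma blocker_edge S : blocker S != set0 -> blocker S \in H.
Proof. by rewrite /blocker; case: pickP => [h /andP[]|]; rewrite ?eqxx. Qed.

Definition closed h S :=
  (S \subset h) && [forall B : {set V}, (B \subset S) ==> (blocker B :&: h \subset S)].

Definition hull h A := \bigcap_(S : {set V} | (A \subset S) && closed h S) S.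

Lemma closed_self h : closed h h.
Proof. by rewrite /closed subxx; apply/forallP=> B; rewrite subsetIr implybT. Qed.

Lemma closed_sub h S : closed h S -> S \subset h. Proof. by case/andP. Qed.

Lemma closedI h S W : closed h S -> closed h W -> closed h (S :&: W).
Proof.
move=> /andP[Sh /forallP cS] /andP[_ /forallP cW].
apply/andP; split; first exact: subset_trans (subsetIl _ _) Sh.
apply/forallP=> B; rewrite subsetI; apply/implyP=> /andP[BS BW].
by rewrite subsetI (implyP (cS B)) // (implyP (cW B)).
Qed.

Lemma hull_closed h A : A \subset h -> closed h (hull h A).
Proof.
move=> Ah; apply/andP; split.
  by apply: bigcap_inf; rewrite Ah closed_self.
apply/forallP=> B; apply/implyP=> /bigcapsP BA; apply/bigcapsP=> S AS.
by have /andP[_ /andP[_ /forallP/(_ B)/implyP]] := AS; apply; apply: BA.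
Qed.

Lemma sub_hull h A : A \subset hull h A.
Proof. by apply/bigcapsP=> S /andP[]. Qed.

Lemma hull_min h A S : A \subset S -> closed h S -> hull h A \subset S.
Proof. by move=> AS cS; apply: bigcap_inf; rewrite AS. Qed.

Lemma hull_mono h A B : A \subset B -> B \subset h -> hull h A \subset hull h B.
Proof.
move=> AB Bh; apply: hull_min; last exact: hull_closed.
exact: subset_trans AB (sub_hull _ _).
Qed.

(** If S were not free, then h itself, being an edge that contains S, would
meet the blocker of S outside S, against closedness. *)
Lemma closed_free h S : h \in H -> closed h S -> free S.
Proof.
move=> hH /andP[Sh /forallP/(_ S)]; rewrite subxx /= setIC => bS.
by apply: contraTT bS => nfS; apply: blockerP.
Qed.

Definition spanned A := [set h in H | (A \subset h) && (hull h A == h)].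

(** Encoding of h by the vertices that are added to A one at a time: if A is
not closed in h, some blocker of a subset of A contains a vertex of h outside
A, and all these blockers together have at most 2^k k vertices. *)
Lemma card_spanned k j A : kgraph k H -> k = j + #|A| ->
  #|spanned A| <= (2 ^ k * k) ^ j.
Proof.
move=> Hk; elim: j A => [|j IH] A ek.
  apply: leq_trans (_ : #|[set A]| <= _); last by rewrite cards1.
  apply/subset_leq_card/subsetP=> h /[!inE] /and3P[hH Ah _].
  by rewrite eq_sym eqEcard Ah (Hk h hH) ek add0n leqnn.
pose U := (\bigcup_(B in powerset A) blocker B) :\: A.
have cU : #|U| <= 2 ^ k * k.
  apply: leq_trans (subset_leq_card (subsetDl _ _)) _.
  have cB B : B \in powerset A -> #|blocker B| <= k.
    have [->|/blocker_edge bH] := eqVneq (blocker B) set0; first by rewrite cards0.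
    by rewrite Hk.
  apply: leq_trans (card_bigcup cB) _.
  by rewrite card_powerset leq_mul2r leq_exp2l // ek leq_addl orbT.
have sU : spanned A \subset \bigcup_(x in U) spanned (x |: A).
  apply/subsetP=> h /[!inE] /and3P[hH Ah /eqP hA].
  have : ~~ closed h A.
    apply/negP=> cA; have := subset_leq_card (hull_min (subxx A) cA).
    by rewrite hA (Hk h hH) ek addSn ltnNge leq_addl.
  rewrite /closed Ah /= negb_forall => /existsP[B].
  rewrite negb_imply => /andP[BA /subsetPn[x /setIP[xB xh] xA]].
  apply/bigcupP; exists x.
    by rewrite !inE xA; apply/bigcupP; exists B; rewrite ?powersetE.
  have xAh : x |: A \subset h by rewrite subUset sub1set xh.
  rewrite inE hH xAh eqEsubset (closed_sub (hull_closed xAh)) /=.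
  by rewrite -{1}hA hull_mono // subsetUr.
apply: leq_trans (subset_leq_card sU) _.
apply: leq_trans (card_bigcup (b := (2 ^ k * k) ^ j) _) _.
  move=> x /setDP[_ xA]; apply: IH; by rewrite cardsU1 xA ek; lia.
by rewrite expnS leq_mul2r cU orbT.
Qed.
End Closure.

(** * Admissible intersections *)

(** The condition [allowed], with the threshold c as a parameter. *)
Definition admissible (t c s : nat) : bool := (t %| s) || (c <= s).

(** If s were a multiple of t below c, then s + t <= c, so s + d would lie
strictly between two consecutive multiples of t and below c. *)
Lemma admissible_gap t c s d : t %| c -> admissible t c s ->
  admissible t c (s + d) -> 0 < d -> d < t -> c <= s.
Proof.
rewrite /admissible => tc /orP[ts|//] As d0 dt; rewrite leqNgt; apply/negP => sc.
have tle : t <= c - s by rewrite dvdn_leq ?subn_gt0 // dvdn_subr // ltnW.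
case/orP: As => [|cs]; last by lia.
by rewrite dvdn_addr // => /(dvdn_leq d0); lia.
Qed.

Section Structure.
Variables (t l c : nat).
Hypotheses (ht : 1 < t) (tc : t %| c) (t_leq_c : t <= c) (l_gt1 : 1 < l).
Hypothesis (lt_eq : l * t = c + l).
Variables (V : finType) (H : {set {set V}}).
Hypothesis H_uniform : kgraph (c + l) H.
Hypothesis H_inter :
  forall e f, e \in H -> f \in H -> admissible t c #|e :&: f|.
Implicit Types (A B S W C e f h : {set V}) (v w x y : V).

Lemma admissible_free_edge S f : free H S -> f \in H -> admissible t c #|S :&: f|.
Proof.
move=> fS fH; have [e [eH Se ef]] := freeP fS fH.
have <- : e :&: f = S :&: f.
  by apply/eqP; rewrite eqEsubset subsetI ef subsetIr /= setSI.
exact: H_inter.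
Qed.

Lemma admissible_free2 h S W : h \in H -> free H S -> free H W -> admissible t c #|S :&: W|.
Proof.
move=> hH fS fW; have [e [eH Se _]] := freeP fS hH.
have [f [fH Wf fe]] := freeP fW eH.
have <- : S :&: f = S :&: W.
  apply/eqP; rewrite eqEsubset subsetI subsetIl (setIS S Wf) andbT /=.
  apply: subset_trans fe; rewrite subsetI subsetIr.
  exact: subset_trans (subsetIl _ _) Se.
exact: admissible_free_edge.
Qed.

Definition insepb W := [forall h in H, (W :&: h == set0) || (W :&: h == W)].

Lemma insepP W : reflect (inseparable H W) (insepb W).
Proof.
apply: (iffP forallP) => [iW h hH | iW h].
  by have /implyP/(_ hH)/orP[] := iW h => /eqP; [left | right].
by apply/implyP=> hH; have [->|->] := iW h hH; rewrite eqxx ?orbT.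
Qed.

Lemma insep_meet W f x : inseparable H W -> f \in H -> x \in W -> x \in f -> W \subset f.
Proof.
move=> iW fH xW xf; have [/setP/(_ x)|<-] := iW f fH; last exact: subsetIr.
by rewrite !inE xW xf.
Qed.

Lemma insep_free W S h x : inseparable H W -> free H S -> h \in H -> S \subset h ->
  x \in W -> x \in S -> W \subset S.
Proof.
move=> iW fS hH Sh xW xS; have [f [fH Sf fh]] := freeP fS hH.
apply: subset_trans fh; rewrite subsetI !(insep_meet iW _ xW) //.
  exact: (subsetP Sh).
exact: (subsetP Sf).
Qed.

(** * The three classes of vertices *)

Definition VT : {set V} := \bigcup_(W in [set W : {set V} | (#|W| == t) && insepb W]) W.

Lemma VTP x : reflect (exists W, [/\ #|W| = t, inseparable H W & x \in W]) (x \in VT).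
Proof.
apply: (iffP bigcupP) => [[W /[!inE] /andP[/eqP cW /insepP iW] xW]|[W [cW iW xW]]].
  by exists W.
by exists W; rewrite ?inE ?cW ?eqxx //=; apply/insepP.
Qed.

(** The vertex y belongs to the body, and C is the centre, of a potential
star. *)
Definition tip C y := [&& #|C| == c, y \notin C, free H C & free H (y |: C)].

Definition VS : {set V} := [set y | (y \notin VT) && [exists C, tip C y]].
Definition VR : {set V} := ~: (VT :|: VS).

(** The sizes of C :&: f and of (y |: C) :&: f differ by 1 and are both
admissible, so the first is at least c = #|C|. *)
Lemma tip_edge C y f : tip C y -> f \in H -> y \in f -> C \subset f.
Proof.
move=> /and4P[/eqP cC yC fC fyC] fH yf.
have := admissible_gap tc (admissible_free_edge fC fH) (d := 1).
rewrite addn1 => gap.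
suff cf : c <= #|C :&: f|.
  by apply/setIidPl/eqP; rewrite eqEcard subsetIl cC.
apply: gap => //; have := admissible_free_edge fyC fH.
by rewrite setIUl (setIidPl _) ?sub1set // cardsU1 inE (negPf yC).
Qed.

Lemma tip_free C y S h : tip C y -> free H S -> h \in H -> S \subset h -> y \in S ->
  C \subset S.
Proof.
move=> tC fS hH Sh yS; have [f [fH Sf fh]] := freeP fS hH.
apply: subset_trans fh; rewrite subsetI !(tip_edge tC) //.
  exact: (subsetP Sh).
exact: (subsetP Sf).
Qed.

(** The centre of w would be contained in every edge through w, hence in the
free set C, to which it would be equal; but w is not in its own centre. *)
Lemma tip_centre C y C' w h : tip C y -> h \in H -> y \in h -> w \in C -> ~~ tip C' w.
Proof.
move=> tC hH yh wC; apply/negP=> tC'.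
have Ch := tip_edge tC hH yh.
have /and4P[/eqP cC _ fC _] := tC.
have C'C := tip_free tC' fC hH Ch wC.
have /and4P[/eqP cC' wC' _ _] := tC'.
have /eqP eC : C' == C by rewrite eqEcard C'C cC cC' leqnn.
by rewrite eC wC in wC'.
Qed.

Lemma tip_centre_unique C y C' h : tip C y -> tip C' y -> h \in H -> y \in h -> C' = C.
Proof.
move=> tC tC' hH yh; have Ch := tip_edge tC hH yh.
have /and4P[/eqP cC yC _ fyC] := tC.
have yCh : y |: C \subset h by rewrite subUset sub1set yh.
have C'yC := tip_free tC' fyC hH yCh (setU11 _ _).
have /and4P[/eqP cC' yC' _ _] := tC'.
apply/eqP; rewrite eqEcard cC cC' leqnn andbT; apply/subsetP=> z zC'.
by have /setU1P[zy|//] := subsetP C'yC z zC'; rewrite -zy zC' in yC'.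
Qed.

(** * Robust edges *)

Definition robust h v := forall A, v \in A -> A \subset h -> #|A| < l -> hull H h A != h.

Section Edge.
Variable h : {set V}.
Hypothesis hH : h \in H.
Hypothesis robustVR : forall v, v \in h -> v \in VR -> robust h v.

Lemma card_edge : #|h| = c + l.
Proof. exact: H_uniform. Qed.

(** Otherwise A together with the vertices of h outside its hull would
generate h with fewer than l vertices. *)
Lemma card_hull v A : v \in h -> v \in VR -> v \in A -> A \subset h ->
  #|hull H h A| <= c + #|A|.
Proof.
move=> vh vR vA Ah; rewrite leqNgt; apply/negP=> big.
have cl := hull_closed H Ah; have clh := closed_sub cl.
pose B := A :|: (h :\: hull H h A).
have Bh : B \subset h by rewrite subUset Ah subsetDl.
have := robustVR vh vR (A := B); rewrite inE vA => /(_ isT Bh) => nB.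
have : hull H h B == h.
  rewrite eqEsubset (closed_sub (hull_closed H Bh)) /=.
  apply/subsetP=> z zh; case: (boolP (z \in hull H h A)) => zA.
    by apply: (subsetP (hull_mono H _ Bh)) zA; apply: subsetUl.
  by apply: (subsetP (sub_hull H h B)); rewrite !inE zA zh orbT.
apply/negP/nB; apply: leq_ltn_trans (leq_card_setU _ _) _.
have := cardsD h (hull H h A); rewrite (setIidPr clh) card_edge => ->.
have := subset_leq_card clh; move: big; rewrite card_edge; clear; lia.
Qed.

Lemma VR_free_star x C : x \in VR -> x \notin C -> #|C| = c -> free H C ->
  ~~ free H (x |: C).
Proof.
move=> xR xC cC fC; apply/negP=> fxC; move: xR.
rewrite !inE negb_or negb_and negbK => /andP[/negPf->] /= /existsP[].
by exists C; rewrite /tip cC eqxx xC fC.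
Qed.

(** [admissible_gap] for the closed sets S and hull (x |: S): the two
intersections with W differ by at least 1, because of x, and by less than t. *)
Lemma trace_jump S x W : closed H h S -> x \in h -> x \notin S ->
  #|hull H h (x |: S)| < #|S| + t -> free H W -> x \in W -> c <= #|W :&: S|.
Proof.
move=> cS xh xS jump fW xW.
have xSh : x |: S \subset h by rewrite subUset sub1set xh (closed_sub cS).
have clS := hull_closed H xSh.
set S' := hull H h (x |: S) in clS jump.
have SS' : S \subset S' by apply: subset_trans (sub_hull _ _ _); apply: subsetUr.
have xS' : x \in S' by apply: (subsetP (sub_hull _ _ _)); apply: setU11.
have fS := closed_free hH cS; have fS' := closed_free hH clS.
have sub : W :&: S \subset W :&: S' by apply: setIS.
have cW' : #|W :&: S'| = #|W :&: S| + #|(W :&: S') :\: S|.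
  by rewrite -(cardsID S (W :&: S')) -setIA (setIidPr SS').
apply: (admissible_gap tc (d := #|(W :&: S') :\: S|)).
- exact: admissible_free2 hH fW fS.
- by rewrite -cW'; apply: admissible_free2 hH fW fS'.
- by apply/card_gt0P; exists x; rewrite !inE xS xW xS'.
apply: leq_ltn_trans (_ : #|S' :\: S| < t).
  by apply/subset_leq_card/setSD/subsetIr.
rewrite cardsD (setIidPr SS'); move: jump ht; clear; lia.
Qed.

(** A smaller jump is impossible for x in VT, whose inseparable t-set would be
disjoint from S and contained in the new hull. If x is in VR, the hull of x has
at most c + 1 vertices and, by [trace_jump], at least c of them in S: its
intersection with S is then a free centre for x, which makes x a tip. *)
Lemma jump_geq S x : h :&: VS = set0 -> closed H h S -> x \in h -> x \notin S ->
  #|S| + t <= #|hull H h (x |: S)|.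
Proof.
move=> noS cS xh xS; rewrite leqNgt; apply/negP=> jump.
have trS W := @trace_jump S x W cS xh xS jump.
have xSh : x |: S \subset h by rewrite subUset sub1set xh (closed_sub cS).
have fS := closed_free hH cS.
have xR : x \in VR.
  move/setP/(_ x): noS; rewrite in_setI xh in_set0 /= => xVS.
  rewrite in_setC in_setU xVS orbF; apply/VTP=> -[W [cW iW xW]].
  (* The t-set W lies in the new hull and avoids S. *)
  have WS' : W \subset hull H h (x |: S).
    apply: (insep_free iW (closed_free hH (hull_closed H xSh)) hH _ xW).
      exact/closed_sub/hull_closed.
    by apply: (subsetP (sub_hull _ _ _)); apply: setU11.
  have dWS : [disjoint S & W].
    rewrite disjoints_subset; apply/subsetP=> z zS; rewrite inE.
    apply: contra xS => zW.
    exact: (subsetP (insep_free iW fS hH (closed_sub cS) zW zS)).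
  have : S :|: W \subset hull H h (x |: S).
    rewrite subUset WS' andbT; apply: subset_trans (sub_hull _ _ _).
    exact: subsetUr.
  move/subset_leq_card; rewrite cardsU (eqP (_ : S :&: W == set0)) ?setI_eq0 //.
  rewrite cards0 cW; move: jump; clear; lia.
have xh1 : [set x] \subset h by rewrite sub1set.
have clx := hull_closed H xh1; set W := hull H h [set x] in clx.
have fW := closed_free hH clx.
have xW : x \in W by apply: (subsetP (sub_hull _ _ _)); apply: set11.
have cW : #|W| <= c + 1.
  by have := card_hull xh xR (set11 x) xh1; rewrite cards1.
have cWS := trS W fW xW.
have xWS : x \notin W :&: S by rewrite inE (negPf xS) andbF.
have eW : x |: (W :&: S) = W.
  apply/eqP; rewrite eqEcard subUset sub1set xW subsetIl /= cardsU1 xWS.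
  by move: cW cWS; clear; lia.
have fWS : free H (W :&: S) by apply: (closed_free hH); apply: closedI.
have : #|W :&: S| = c.
  by move: cW cWS; rewrite -{1}eW cardsU1 xWS; clear; lia.
by move/(VR_free_star xR xWS)/(_ fWS); rewrite eW fW.
Qed.
(** If x is outside C, the hull of x and y can only be C + x + y. The hull of x
does not contain y, so it consists of x and of a part of C; comparing its size
with that of its intersection with C, this part is all of C and x is a tip. *)
Lemma VR_in_tip y C x : tip C y -> y \in h -> x \in h -> x \in VR -> x \in C.
Proof.
move=> tC yh xh xR; apply/negPn/negP=> xC.
have Ch := tip_edge tC hH yh.
have /and4P[/eqP cC yC fC fyC] := tC.
have xh1 : [set x] \subset h by rewrite sub1set.
have clx := hull_closed H xh1; set W := hull H h [set x] in clx.
have xW : x \in W by apply: (subsetP (sub_hull _ _ _)); apply: set11.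
have fW := closed_free hH clx.
have cW : #|W| <= c + 1.
  by have := card_hull xh xR (set11 x) xh1; rewrite cards1.
have neq : x != y.
  apply: contraTneq xR => ->; rewrite in_setC in_setU negbK orbC inE.
  case: (y \in VT) => //=; apply/orP; left.
  by apply/existsP; exists C.
have yW : y \notin W.
  apply/negP=> yW; have CW := tip_free tC fW hH (closed_sub clx) yW.
  have : x |: (y |: C) \subset W by rewrite !subUset !sub1set xW yW.
  move/subset_leq_card; rewrite !cardsU1 !inE (negPf neq) (negPf xC) (negPf yC) cC.
  by move: cW; clear; lia.
have xy : [set x; y] \subset h by rewrite subUset !sub1set xh.
have clxy := hull_closed H xy; set P := hull H h [set x; y] in clxy.
have cP : #|P| <= c + 2.
  by have := card_hull xh xR (set21 x y) xy; rewrite cards2 neq.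
have xP : x \in P by apply: (subsetP (sub_hull _ _ _)); apply: set21.
have yP : y \in P by apply: (subsetP (sub_hull _ _ _)); apply: set22.
have CP := tip_free tC (closed_free hH clxy) hH (closed_sub clxy) yP.
have eP : x |: (y |: C) = P.
  apply/eqP; rewrite eqEcard !subUset !sub1set xP yP CP /=.
  rewrite !cardsU1 !inE (negPf neq) (negPf xC) (negPf yC) cC.
  by move: cP; clear; lia.
have WP : W \subset P.
  by apply: hull_min clxy; rewrite sub1set.
have eW : x |: (W :&: C) = W.
  apply/eqP; rewrite eqEsubset subUset sub1set xW subsetIl /=.
  apply/subsetP=> z zW; have := subsetP WP z zW; rewrite -eP !inE zW.
  by case: eqP => // _; case: eqP => // zy; rewrite zy (negPf yW) in zW.
have xWC : x \notin W :&: C by rewrite inE (negPf xC) andbF.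
have cWC : c <= #|W :&: C|.
  apply: (admissible_gap tc (d := 1)) => //; first exact: admissible_free2 hH fW fC.
  have := admissible_free2 hH fW fW; rewrite setIid -{1}eW cardsU1 xWC.
  by rewrite addnC.
have eC : W :&: C = C by apply/eqP; rewrite eqEcard subsetIr cC.
have := VR_free_star xR xC cC fC.
by rewrite -eC eW fW.
Qed.

(** The hull of v has at most c + 1 vertices. Size c + 1 is excluded because
robustness allows only c + 2 vertices for the hull of v and one more vertex,
which is too small a jump; so the size is a multiple of t. Size t is
excluded because every edge would meet the hull in 0 or t vertices, which puts
v in VT. *)
Lemma card_hull_VR v : h :&: VS = set0 -> v \in h -> v \in VR ->
  2 * t <= #|hull H h [set v]|.
Proof.
move=> noS vh vR.
have vh1 : [set v] \subset h by rewrite sub1set.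
have clv := hull_closed H vh1; set M := hull H h [set v] in clv.
have vM : v \in M by apply: (subsetP (sub_hull _ _ _)); apply: set11.
have fM := closed_free hH clv.
have cM : #|M| <= c + 1.
  by have := card_hull vh vR (set11 v) vh1; rewrite cards1.
have tM : t %| #|M|.
  have := admissible_free2 hH fM fM; rewrite setIid /admissible => /orP[//|cM'].
  have [->//|cM1] := eqVneq #|M| c.
  have {cM' cM1}cM : #|M| = c + 1 by move: cM cM' cM1; clear; lia.
  have [x xh xM] : exists2 x, x \in h & x \notin M.
    apply/subsetPn/negP=> /subset_leq_card; rewrite card_edge cM leq_add2l.
    by rewrite leqNgt l_gt1.
  have vx : [set v; x] \subset h by rewrite subUset vh1 sub1set.
  have neq : v != x by apply: contraNneq xM => <-.
  have sub : hull H h (x |: M) \subset hull H h [set v; x].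
    apply: hull_min (hull_closed H vx); rewrite subUset.
    rewrite hull_mono ?subsetUl // andbT sub1set.
    by apply: (subsetP (sub_hull _ _ _)); apply: set22.
  have := card_hull vh vR (set21 v x) vx; rewrite cards2 neq /=.
  have := subset_leq_card sub; have := jump_geq noS clv xh xM.
  by rewrite cM; move: ht; clear; lia.
have M0 : 0 < #|M| by apply/card_gt0P; exists v.
rewrite leqNgt; apply/negP=> small.
have {small} cMt : #|M| = t.
  by case/dvdnP: tM small M0 => [[|[|q]]] -> //; rewrite ?mul1n //; clear; nia.
move: vR; rewrite in_setC in_setU negb_or => /andP[/VTP[]].
exists M; split=> // e eH; have := admissible_free_edge fM eH.
have leM : #|M :&: e| <= t by rewrite -cMt subset_leq_card ?subsetIl.
have full : t <= #|M :&: e| -> M :&: e = M.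
  by move=> te; apply/eqP; rewrite eqEcard subsetIl cMt.
case/orP=> [te | ce]; last by right; apply: full; apply: leq_trans ce.
have [/eqP|pos] := posnP #|M :&: e|; first by rewrite cards_eq0 => /eqP; left.
by right; apply: full; apply: dvdn_leq.
Qed.

(** Starting from 2 t vertices and growing by t at each step, l - 1 vertices
generate h. *)
Lemma VS_meets v : v \in h -> v \in VR -> h :&: VS != set0.
Proof.
move=> vh vR; apply/negP=> /eqP noS.
have vh1 : [set v] \subset h by rewrite sub1set.
have M2 := card_hull_VR noS vh vR.
have grow i : exists A, [/\ v \in A, A \subset h, #|A| <= i.+1 &
    (hull H h A == h) || (i.+2 * t <= #|hull H h A|)].
  elim: i => [|i [A [vA Ah cA /orP[full|big]]]].
  - by exists [set v]; rewrite set11 vh1 cards1 M2 orbT.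
  - by exists A; rewrite vA Ah full (leq_trans cA).
  have cl := hull_closed H Ah.
  have [full|neq] := eqVneq (hull H h A) h.
    by exists A; rewrite vA Ah full eqxx (leq_trans cA).
  have [x xh xA] : exists2 x, x \in h & x \notin hull H h A.
    by apply/subsetPn; move: neq; rewrite eqEsubset (closed_sub cl).
  have xAh : x |: A \subset h by rewrite subUset sub1set xh.
  exists (x |: A); split=> //; first by rewrite inE vA orbT.
    by rewrite cardsU1; move: cA; case: (_ \notin _); clear; lia.
  apply/orP; right; rewrite mulSn addnC.
  apply: (@leq_trans (#|hull H h A| + t)); first by rewrite leq_add2r.
  apply: leq_trans (jump_geq noS cl xh xA) (subset_leq_card _).
  apply: hull_min (hull_closed H xAh); rewrite subUset.
  rewrite hull_mono ?subsetUr // andbT sub1set.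
  by apply: (subsetP (sub_hull _ _ _)); apply: setU11.
(* l - 1 vertices suffice, because l * t = c + l is the size of h. *)
have [A [vA Ah cA hA]] := grow l.-2.
have cA' : #|A| < l by move: cA l_gt1; clear; lia.
have := robustVR vh vR vA Ah cA'; case/orP: hA => [-> // | big].
rewrite eqEcard (closed_sub (hull_closed H Ah)) /= card_edge -lt_eq.
by move: big; rewrite -[in l.-2.+2](subnK l_gt1) addn2 /= -addn2 subnK // => ->.
Qed.

Lemma robust_edge :
  (forall y C x, y \in h -> y \in VS -> tip C y -> x \in h -> x \in VT -> x \in C) ->
  ~~ (h \subset VT) -> #|h :&: VS| = l.
Proof.
move=> cross nT.
have [y /setIP[yh yS]] : exists y, y \in h :&: VS.
  apply/set0Pn; case: (boolP [exists v in h, v \in VR]) => [/existsP[v /andP[]]|].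
    exact: VS_meets.
  rewrite negb_exists => /forallP noR.
  have [x xh xT] := subsetPn nT; apply/set0Pn; exists x; rewrite in_setI xh.
  by have := noR x; rewrite xh /= in_setC in_setU (negPf xT) negbK.
have := yS; rewrite inE => /andP[yT /existsP[C tC]].
have Ch := tip_edge tC hH yh.
have /and4P[/eqP cC _ _ _] := tC.
have -> : h :&: VS = h :\: C.
  apply/setP=> x; rewrite in_setI in_setD.
  case: (boolP (x \in h)) => xh; rewrite ?andbF ?andbT //=.
  apply/idP/idP=> [xS|xC].
    apply/negP=> xC; move: xS; rewrite inE => /andP[_ /existsP[C' tC']].
    by have := tip_centre C' tC hH yh xC; rewrite tC'.
  apply: contraR xC => xS; case: (boolP (x \in VT)) => xT.
    exact: cross tC xh xT.
  by apply: (VR_in_tip tC yh xh); rewrite in_setC in_setU (negPf xT) (negPf xS).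
by rewrite cardsD (setIidPr Ch) cC card_edge addKn.
Qed.
End Edge.

(** * Counting the exceptional edges *)

Definition fragile v : {set {set V}} :=
  [set h in H | (v \in h) && [exists A : {set V},
     [&& v \in A, A \subset h, #|A| < l & hull H h A == h]]].

Definition crossing x y : {set {set V}} :=
  [set h in H | [&& y \in h, x \in h & [exists C, tip C y && (x \notin C)]]].

(** Hulls grow with the generating set, so a fragile edge is already the hull of
a set of exactly l - 1 vertices including v: l - 2 of them are arbitrary, and
[card_spanned] bounds the edges with a given generating set. *)
Lemma card_fragile v :
  #|fragile v| <= (2 ^ (c + l) * (c + l)) ^ (c + l) * #|V| ^ (l - 2).
Proof.
pose F := [set A : {set V} | [set v] \subset A & #|A| == l - 2 + #|[set v]|].
have sub : fragile v \subset \bigcup_(A in F) spanned H A.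
  apply/subsetP=> h /[!inE] /and3P[hH vh /existsP[A /and4P[vA Ah cA /eqP hA]]].
  have [B [AB Bh cB]] : exists B, [/\ A \subset B, B \subset h & #|B| = l - 1].
    apply: extend_subset => //; first by move: cA; clear; lia.
    by rewrite H_uniform //; clear; lia.
  apply/bigcupP; exists B; rewrite !inE.
    by rewrite sub1set (subsetP AB) //= cB cards1; move: l_gt1; clear; lia.
  rewrite hH Bh eqEsubset (closed_sub (hull_closed H Bh)) /= -{1}hA.
  exact: hull_mono.
apply: leq_trans (subset_leq_card sub) _.
apply: leq_trans (card_bigcup (b := (2 ^ (c + l) * (c + l)) ^ (c + l)) _) _.
  move=> A /[!inE] /andP[_ /eqP]; rewrite cards1 => cA.
  apply: leq_trans (card_spanned (j := c + 1) H_uniform _) _.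
    by rewrite cA; move: l_gt1; clear; lia.
  rewrite leq_pexp2l ?leq_add2l ?(ltnW l_gt1) // muln_gt0 expn_gt0 /=.
  by rewrite addn_gt0 (ltnW l_gt1) orbT.
by rewrite mulnC leq_mul2l card_supersets orbT.
Qed.

(** These edges contain y, its centre C and the inseparable t-set of x. The
latter is disjoint from C: C is free, so otherwise C would contain all of it,
and x in particular. There remain l - 1 - t <= l - 3 vertices to choose. *)
Lemma card_crossing x y : x \in VT -> y \in VS ->
  #|crossing x y| <= if l < 3 then 0 else #|V| ^ (l - 3).
Proof.
move=> /VTP[B [cB iB xB]]; rewrite inE => /andP[yT _].
have [->|/set0Pn[h]] := eqVneq (crossing x y) set0; first by rewrite cards0.
rewrite inE => /and4P[hH yh xh /existsP[C /andP[tC xC]]].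
have /and4P[/eqP cC yC fC _] := tC.
have yB : y \notin B by apply: contra yT => yB; apply/VTP; exists B.
have dBC : [disjoint B & C].
  rewrite disjoints_subset; apply/subsetP=> z zB; rewrite inE.
  apply: contra xC => zC.
  exact: (subsetP (insep_free iB fC hH (tip_edge tC hH yh) zB zC)).
pose Q := y |: (B :|: C).
have cQ : #|Q| = t + c + 1.
  rewrite cardsU1 inE (negPf yB) (negPf yC) cardsU (eqP (_ : B :&: C == set0)) ?setI_eq0 //.
  by rewrite cards0 cB cC subn0 addnC.
have Qs g : g \in crossing x y -> Q \subset g.
  rewrite inE => /and4P[gH yg xg _].
  by rewrite !subUset sub1set yg (insep_meet iB gH xB xg) (tip_edge tC gH yg).
have Qh : #|Q| <= c + l.
  rewrite -(H_uniform hH); apply/subset_leq_card/Qs.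
  by rewrite inE hH yh xh; apply/existsP; exists C; rewrite tC.
have l3 : t + 1 <= l by move: Qh; rewrite cQ; clear; lia.
rewrite ltnNge (leq_trans _ l3) /=; last by rewrite addn1.
have V0 : 0 < #|V| by apply/card_gt0P; exists y.
apply: leq_trans (_ : #|V| ^ (l - (t + 1)) <= _); last first.
  by rewrite leq_pexp2l // leq_sub2l // addn1.
apply: leq_trans (card_supersets Q _); apply/subset_leq_card/subsetP=> g gx.
rewrite inE Qs //= H_uniform; last by move: gx; rewrite inE => /andP[].
by rewrite cQ; move: l3; clear; lia.
Qed.

Definition HS : {set {set V}} := [set h in H | #|h :&: VS| == l].
Definition HR : {set {set V}} := H :\: (induced H VT :|: HS).

(** An edge in none of these families satisfies the hypotheses of
[robust_edge]. *)
Lemma HR_cover : HR \subset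
  (\bigcup_(x in VT) \bigcup_(y in VS) crossing x y)
    :|: \bigcup_(v in VR) fragile v.
Proof.
apply/subsetP=> h; rewrite !inE negb_or !negb_and => /andP[/andP[nT nS] hH].
rewrite hH /= in nT nS.
apply/negPn/negP; rewrite negb_or => /andP[ncr nfl].
case/negP: nS; apply/eqP; apply: robust_edge => //.
- move=> v vh vR A vA Ah cA; apply: contraNneq nfl => hA.
  apply/bigcupP; exists v => //; rewrite inE hH vh.
  by apply/existsP; exists A; rewrite vA Ah cA hA eqxx.
- move=> y C x yh yS tC xh xT; apply: contraNT ncr => xC.
  apply/bigcupP; exists x => //; apply/bigcupP; exists y => //.
  by rewrite inE hH yh xh; apply/existsP; exists C; rewrite tC.
Qed.

Lemma card_HR : #|HR| <= #|VT| * (#|VS| * (if l < 3 then 0 else #|V| ^ (l - 3)))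
  + #|VR| * ((2 ^ (c + l) * (c + l)) ^ (c + l) * #|V| ^ (l - 2)).
Proof.
apply: leq_trans (subset_leq_card HR_cover) _.
apply: leq_trans (leq_card_setU _ _) (leq_add _ _).
  apply: card_bigcup => x xT; apply: card_bigcup => y; exact: card_crossing.
by apply: card_bigcup => v _; apply: card_fragile.
Qed.

(** * The stars *)

(** The edges of a star are the edges of HS with the same part outside VS; this
part is the common centre of all their tips ([HS_centre]). *)
Definition star_at (S : {set V}) : {set {set V}} * {set V} :=
  ([set h in HS | h :\: VS == S], S).

Definition stars := [set star_at (h :\: VS) | h in HS].

Lemma HS_centre h y : h \in HS -> y \in h -> y \in VS -> tip (h :\: VS) y.
Proof.
rewrite inE => /andP[hH /eqP cS] yh; rewrite inE => /andP[_ /existsP[C tC]].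
suff -> : h :\: VS = C by [].
have Ch := tip_edge tC hH yh; have /and4P[/eqP cC _ _ _] := tC.
apply/esym/eqP; rewrite eqEcard cardsD H_uniform // cS addnK cC leqnn andbT.
apply/subsetP=> x xC; rewrite in_setD (subsetP Ch) // andbT inE negb_and negbK.
apply/orP; right; apply/existsP=> -[C' tC'].
by have := tip_centre C' tC hH yh xC; rewrite tC'.
Qed.

Lemma body_star S y : y \in body (star_at S) ->
  [/\ y \in VS, tip S y & exists2 h, h \in H & y \in h].
Proof.
case/bigcupP=> h; rewrite inE => /andP[hS /eqP eS].
rewrite inE => /andP[yS yh].
have yVS : y \in VS by move: yS; rewrite /centre /= -eS in_setD yh andbT negbK.
split=> //; first by rewrite -eS; apply: HS_centre.
by exists h => //; move: hS; rewrite inE => /andP[].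
Qed.

Lemma partition3_vertices : partition3 [set: V] VT VS VR.
Proof.
split; first by rewrite setUCr.
- by rewrite disjoints_subset; apply/subsetP=> x xT; rewrite !in_setC inE xT.
- by rewrite disjoints_subset setCK subsetUl.
- by rewrite disjoints_subset setCK subsetUr.
Qed.

Lemma partition3_edges : partition3 H (induced H VT) HS HR.
Proof.
have sub : induced H VT :|: HS \subset H.
  by rewrite subUset; apply/andP; split; apply/subsetP=> h /[!inE] /andP[].
split.
- by rewrite -[RHS](setID H (induced H VT :|: HS)) (setIidPr sub).
- rewrite disjoints_subset; apply/subsetP=> h; rewrite !inE => /andP[hH hT].
  rewrite hH /= (_ : h :&: VS = set0) ?cards0 //; first by move: l_gt1; case: l.
  apply/eqP; rewrite setI_eq0 disjoints_subset; apply: subset_trans hT _.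
  by have [_ + _ _] := partition3_vertices; rewrite disjoints_subset.
- by rewrite disjoints_subset setCD (subset_trans (subsetUl _ HS)) ?subsetUr.
- by rewrite disjoints_subset setCD (subset_trans (subsetUr (induced H VT) _)) ?subsetUr.
Qed.

Lemma stars_semi_disjoint : semi_disjoint stars.
Proof.
move=> X Y /imsetP[h hS ->] /imsetP[g gS ->] neq; split.
  by apply: contraNneq neq => /= ->.
rewrite -setI_eq0; apply: contraNT neq => /set0Pn[y /setIP[]].
move=> /body_star[_ th [e eH ye]] /body_star[_ tg _]; apply/eqP; congr star_at.
exact: tip_centre_unique tg th eH ye.
Qed.

Lemma HS_bigcup : HS = \bigcup_(X in stars) star_edges X.
Proof.
apply/setP=> h; apply/idP/bigcupP=> [hS|[X /imsetP[g gS ->]]].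
  by exists (star_at (h :\: VS)); [apply: imset_f | rewrite inE hS eqxx].
by rewrite inE => /andP[].
Qed.

Lemma stars_are_stars X : X \in stars -> is_star (l * t) (l * (t - 1)) X.
Proof.
move=> /imsetP[g gS ->]; split.
- move=> h; rewrite inE => /andP[hS _]; rewrite lt_eq H_uniform //.
  by move: hS; rewrite inE => /andP[].
- move: gS; rewrite inE => /andP[gH /eqP cS].
  by rewrite /centre /= cardsD cS H_uniform // mulnBr muln1 lt_eq.
- by move=> h; rewrite inE => /andP[_ /eqP <-]; apply: subsetDl.
Qed.

Lemma stars_location X : X \in stars ->
  centre X \subset VT :|: VR /\ body X \subset VS.
Proof.
move=> /imsetP[g gS ->]; split; last by apply/subsetP=> y /body_star[].
apply/subsetP=> x; rewrite in_setD => /andP[xS _].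
by rewrite in_setU in_setC in_setU (negPf xS) orbF orbN.
Qed.

Lemma stars_absorb X h : X \in stars -> h \in H -> h :&: body X != set0 ->
  centre X \subset h.
Proof.
move=> /imsetP[g gS ->] hH /set0Pn[y /setIP[yh /body_star[_ tS _]]].
exact: tip_edge tS hH yh.
Qed.

Import Order.TTheory GRing.Theory Num.Theory.

Lemma HR_bound_VR a : (2 ^ (c + l) * (c + l)) ^ (c + l) <= a ->
  HR_bound l a VT VS VR HR.
Proof.
move=> a_big; rewrite /HR_bound.
have le1 : (((if l < 3 then 0 else #|V| ^ (l - 3))%N)%:R <= #|V|%:R ^ (l%:Z - 3%:Z) :> rat)%R.
  (* For l = 2 there are no crossing edges, and the exponent is -1. *)
  case: ltnP => [_|l3]; first exact: exprz_ge0.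
  by rewrite subzn // natrX.
have le2 : (((#|V| ^ (l - 2))%N)%:R = #|V|%:R ^ (l%:Z - 2%:Z) :> rat)%R.
  by rewrite subzn // natrX.
apply: (@le_trans _ _ ((#|VT| * (#|VS| * (if l < 3 then 0 else #|V| ^ (l - 3)))
  + #|VR| * (a * #|V| ^ (l - 2)))%N%:R)%R).
  rewrite ler_nat (leq_trans card_HR) // leq_add2l leq_mul2l leq_mul2r.
  by rewrite a_big !orbT.
by rewrite natrD !natrM !mulrA le2 lerD2r ler_wpM2l // mulr_ge0.
Qed.

Lemma inF_of_admissible a : (2 ^ (c + l) * (c + l)) ^ (c + l) <= a ->
  inF t l a H.
Proof.
move=> a_big; split; first by rewrite lt_eq.
exists VT, VS, VR, (induced H VT), HS, HR; split=> //.
- by split; [apply: partition3_vertices | apply: partition3_edges].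
- split=> //; exists [set W : {set V} | (#|W| == t) && insepb W].
  by split=> // W; rewrite inE => /andP[/eqP cW /insepP].
- exists stars; split.
  + exact: HS_bigcup.
  + exact: stars_are_stars.
  + exact: stars_semi_disjoint.
  + exact: stars_location.
  + exact: stars_absorb.
- exact: HR_bound_VR.
Qed.
End Structure.

(** * The theorem *)

Lemma exponent_bound k : 1 < k -> (2 ^ k * k) ^ k <= k ^ (k ^ 3).
Proof.
move=> k1; have k0 : 0 < k by apply: ltnW.
apply: (@leq_trans ((k ^ k * k) ^ k)).
  by rewrite leq_exp2r // leq_mul2r leq_exp2r // k1 orbT.
rewrite -expnSr -expnM leq_exp2l // !expnS expn0 muln1 mulnC leq_mul2l.
by apply/orP; right; nia.
Qed.

Theorem theorem2p2 (r t : nat) (hr : 1 <= r) (ht : 2 <= t)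
    (V : finType) (H : {set {set V}}) :
  inJ r t H -> inF t (r * t) ((r * t ^ 2) ^ (r ^ 3 * t ^ 6)) H.
Proof.
case=> H_uniform H_inter; pose l := r * t; pose c := r * t * (t - 1).
have lt_eq : l * t = c + l by rewrite /c -[X in _ + X]muln1 -mulnDr subnK // ltnW.
have kE : r * t ^ 2 = c + l by rewrite -lt_eq expnS expn1 mulnA.
have t_l : t <= l by rewrite leq_pmull.
apply: (@inF_of_admissible t l c) => //.
- by rewrite dvdn_mulr ?dvdn_mull.
- by rewrite -[X in X <= _]muln1 leq_mul // subn_gt0.
- exact: leq_trans t_l.
- by rewrite -kE.
- have -> : r ^ 3 * t ^ 6 = (r * t ^ 2) ^ 3 by rewrite expnMn -expnM.
  rewrite -kE; apply: exponent_bound; rewrite kE.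
  by apply: leq_trans (leq_addl _ _); apply: leq_trans t_l.
Qed.
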